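(* Let $k>1$ and let $(Q,\cdot)$ be a groupoid of order $n>k$ with $Q=\{1,2,\ldots,n\}$. Then $(Q,\cdot)$ is a $k$-translatable pentagonal quasigroup if and only if it is of the form $x\cdot y=[ax+(1-a)y]_n$, where $$n\mid m=k^4-2k^3+4k^2-3k+1\quad\text{and}\quad a=[-k^3+k^2-3k+1]_n.$$
   Context: $[z]_n$ denotes the residue of $z$ modulo $n$, with $0$ identified with $n$, so residues are represented in $\{1,\ldots,n\}$. A pentagonal quasigroup is a quasigroup satisfying $xx=x$, $\;(xy)(zu)=(xz)(yu)$ and $\big(((xy)x)y\big)x=y$. A quasigroup $(Q,\cdot)$ with $Q=\{1,2,\ldots,n\}$ in its natural ordering is $k$-translatable, where $1\le k<n$, if for each $q\in\{2,\ldots,n\}$ the $q$-th row of its multiplication table is obtained from the $(q-1)$-st row by moving the last $k$ entries to the front (keeping their order) followed by the first $n-k$ entries; equivalently, $i\cdot j=[i+1]_n\cdot[j+k]_n$ for all $i,j\in Q$. *)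

(* Defs.v *)
From mathcomp Require Import all_boot all_order all_algebra.

Set Implicit Arguments.
Unset Strict Implicit.
Unset Printing Implicit Defensive.

Import Order.TTheory GRing.Theory Num.Theory.

(* The carrier is {1, ..., n} itself rather than 'I_n, so that the natural
   ordering is the one in which the multiplication table is written. *)
Definition Q (n : nat) : Type := {i : nat | 0 < i <= n}.

(* [z]_n, with values in {1, ..., n}; only meaningful for n > 0. *)
Definition res (n : nat) (z : int) : nat :=
  if (n%:Z %| z)%Z then n else `|(z %% n%:Z)%Z|%N.

Definition quasigroup (T : Type) (op : T -> T -> T) : Prop :=
  (forall a b : T, exists! x : T, op a x = b) /\
  (forall a b : T, exists! y : T, op y a = b).

Definition pentagonal (T : Type) (op : T -> T -> T) : Prop :=
  [/\ quasigroup op,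
      forall x : T, op x x = x,
      forall x y z u : T, op (op x y) (op z u) = op (op x z) (op y u)
    & forall x y : T, op (op (op (op x y) x) y) x = y].

Definition Q_enum (n : nat) : seq (Q n) := pmap insub (iota 1 n).

Definition table_row (n : nat) (op : Q n -> Q n -> Q n) (q : Q n) : seq (Q n) :=
  [seq op q j | j <- Q_enum n].

(* rotr k s = drop (size s - k) s ++ take (size s - k) s when k <= size s:
   the last k entries of s are moved to the front. *)
Definition translatable (n k : nat) (op : Q n -> Q n -> Q n) : Prop :=
  1 <= k < n /\
  forall p q : Q n, val q = (val p).+1 ->
    table_row op q = rotr k (table_row op p).

(* Main.v *)
Require Import Defs.
From mathcomp Require Import all_boot all_order all_algebra.
From mathcomp Require Import ring.
Import Order.TTheory GRing.Theory Num.Theory.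
Local Open Scope ring_scope.

(** The statement lives in the ring of integers modulo [n]: reducing labels
    identifies {1, ..., n} with ['Z_n], and everything is read off there.

    Translatability says that moving down one row shifts the entries by [k], so
    [x * y] depends only on [y - k x] ([translatable_diagonal]).  Idempotency
    evaluates this function on all of the differences [(1 - k) x], and returns
    [x].  Hence multiplication by [1 - k] is injective on a finite ring, so
    [1 - k] has an inverse [u], and necessarily [x * y = u (y - k x)]
    ([translatable_idempotent_affine]).  The operation is thus affine,
    [x * y = a x + (1 - a) y] with [1 - a = u], and mediality comes for free.

    For such an operation, the identity [(((xy)x)y)x = y] amounts to
    [a^4 - a^3 + a^2 - a + 1 = 0].  As [a = k / (k - 1)], clearing denominators
    turns the left-hand side into [m = k^4 - 2 k^3 + 4 k^2 - 3 k + 1], and the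
    identity [(k - 1) (- k^3 + k^2 - 3 k + 1) = k - m] makes the quotient
    [k / (k - 1)] the stated polynomial in [k].  Conversely [m = 0] makes
    [1 - k] and [1 - a] inverse to each other and [a] a unit, so the affine
    operation is a quasigroup; it is translatable since [a + (1 - a) k = 0]. *)

(** * Polynomial identities *)

Section Identities.
Variable R : comNzRingType.
Implicit Types k a u : R.

Definition modulus_poly k : R := k ^+ 4 - 2 * k ^+ 3 + 4 * k ^+ 2 - 3 * k + 1.

Definition coef_poly k : R := - k ^+ 3 + k ^+ 2 - 3 * k + 1.

(** The product is [1 - modulus_poly k], identically in [k]. *)
Lemma coef_poly_inverse k :
  modulus_poly k = 0 -> (1 - coef_poly k) * (1 - k) = 1.
Proof.
move=> m0; rewrite -[RHS]subr0 -m0 /modulus_poly /coef_poly; ring.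
Qed.

(** [modulus_poly] is the homogenization of [a^4 - a^3 + a^2 - a + 1] at
    numerator [k] and denominator [k - 1], because [a = k / (k - 1)]. *)
Lemma modulus_poly_homogenization k a : (1 - a) * (1 - k) = 1 ->
  (1 - k) ^+ 4 * (a ^+ 4 - a ^+ 3 + a ^+ 2 - a + 1) = modulus_poly k.
Proof.
move=> inv; have ak : a * (1 - k) = - k.
  by rewrite -[a](subKr 1) mulrBl inv; ring.
transitivity ((a * (1 - k)) ^+ 4 - (a * (1 - k)) ^+ 3 * (1 - k)
  + (a * (1 - k)) ^+ 2 * (1 - k) ^+ 2 - a * (1 - k) * (1 - k) ^+ 3
  + (1 - k) ^+ 4); first by ring.
by rewrite ak /modulus_poly; ring.
Qed.

Lemma coef_poly_root k : let a := coef_poly k in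
  modulus_poly k = 0 -> a ^+ 4 - a ^+ 3 + a ^+ 2 - a + 1 = 0.
Proof.
move=> a m0; have inv := coef_poly_inverse k m0; rewrite -/a in inv.
transitivity (((1 - a) * (1 - k)) ^+ 4 * (a ^+ 4 - a ^+ 3 + a ^+ 2 - a + 1)).
  by rewrite inv expr1n mul1r.
by rewrite exprMn -mulrA modulus_poly_homogenization // m0 mulr0.
Qed.

Lemma coef_poly_unique k u :
  modulus_poly k = 0 -> u * (1 - k) = 1 -> 1 - coef_poly k = u.
Proof.
move=> m0 uk; rewrite -[LHS]mulr1 -[X in _ * X = _]uk mulrCA.
by rewrite coef_poly_inverse // mulr1.
Qed.

End Identities.

(** * Labels and residues *)

Lemma res_bounds n z : (0 < n)%N -> (0 < res n z <= n)%N.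
Proof.
move=> n0; rewrite /res; case: ifP => [_|ndvd]; first by rewrite n0 leqnn.
have nz : n%:Z != 0 by rewrite eqz_nat -lt0n.
rewrite absz_gt0; apply/andP; split.
  by apply: contraFN ndvd => /eqP /dvdz_mod0P.
by rewrite -lez_nat gez0_abs ?modz_ge0 // ltW // ltz_pmod.
Qed.

Lemma intr_Zp_eq0 n z : (1 < n)%N -> (z%:~R == 0 :> 'Z_n) = (n%:Z %| z)%Z.
Proof.
move=> n1; have natE d : (d%:R == 0 :> 'Z_n) = (n %| d)%N.
  by rewrite -val_eqE /= val_Zp_nat.
case: z => d; first by rewrite dvdzE -natE -pmulrn.
by rewrite NegzE dvdzE abszN rmorphN oppr_eq0 -natE /= -pmulrn.
Qed.

Lemma res_Zp n z : (1 < n)%N -> (res n z)%:R = z%:~R :> 'Z_n.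
Proof.
move=> n1; rewrite /res; case: ifP => [|_].
  by rewrite -intr_Zp_eq0 // => /eqP ->; rewrite pchar_Zp.
have nz : n%:Z != 0 by rewrite eqz_nat -lt0n ltnW.
rewrite pmulrn gez0_abs ?modz_ge0 // [in RHS](divz_eq z n).
by rewrite [RHS]intrD intrM -[n%:~R]pmulrn pchar_Zp // mulr0 add0r.
Qed.

Definition residue n (x : Q n) : 'Z_n := (val x)%:R.

(** A label below [n] is its own nonzero residue, and the label [n] alone has
    residue [0]. *)
Lemma residue_inj n : (1 < n)%N -> injective (@residue n).
Proof.
move=> n1 x y eq_xy; have := congr1 (@nat_of_ord _) eq_xy.
rewrite /residue !val_Zp_nat // {eq_xy} => eq_ij; apply: val_inj; move: eq_ij.
have /andP[] := valP y; have /andP[] := valP x.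
move: (val x) (val y) => i j i0 iN j0 jN; move: iN jN.
rewrite [(i <= n)%N]leq_eqVlt [(j <= n)%N]leq_eqVlt.
case/orP=> [/eqP->|iN] /orP[/eqP->|jN] //=.
- by rewrite modnn modn_small // => j_eq0; rewrite -j_eq0 in j0.
- by rewrite modnn modn_small // => i_eq0; rewrite i_eq0 in i0.
- by rewrite !modn_small.
Qed.

Definition label n (n1 : (1 < n)%N) (z : 'Z_n) : Q n :=
  exist _ (res n (z : nat)%:Z) (res_bounds n _ (ltnW n1)).

Lemma labelK n (n1 : (1 < n)%N) : cancel (label n n1) (@residue n).
Proof. by move=> z; rewrite /residue /= res_Zp //= -pmulrn natr_Zp. Qed.

(** * Translatability modulo n *)

Lemma val_Q_enum n : map val (Q_enum n) = iota 1 n.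
Proof.
rewrite (pmap_filter (insubK _)); apply/all_filterP/allP => i.
by rewrite mem_iota isSome_insub add1n ltnS.
Qed.

Lemma mem_Q_enum n (x : Q n) : x \in Q_enum n.
Proof.
by rewrite -(mem_map val_inj) val_Q_enum mem_iota add1n ltnS (valP x).
Qed.

(** The rotation puts [i - k] in the place of the label [i] when [k < i], and
    [i + (n - k)] in its place when [i <= k]; both have the residue of [i] minus [k]. *)
Lemma rotr_residue n k : (1 < n)%N -> (k <= n)%N ->
  map (@residue n) (rotr k (Q_enum n))
  = [seq residue n y - k%:R | y <- Q_enum n].
Proof.
move=> n1 kn.
rewrite (map_comp (fun i : nat => i%:R : 'Z_n) val) map_rotr.
rewrite (map_comp (fun i : nat => i%:R - k%:R : 'Z_n) val) val_Q_enum.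
have -> : rotr k (iota 1 n) = iota (n - k + 1) k ++ iota 1 (n - k).
  rewrite /rotr size_iota -[in iota 1 n](subnK kn) iotaD addnC.
  by rewrite -[X in rot X](size_iota 1) rot_size_cat.
rewrite -[in iota 1 n](subnKC kn) iotaD !map_cat; congr (_ ++ _).
  rewrite iotaDl -map_comp; apply: eq_map => i /=.
  by rewrite natrD natrB // pchar_Zp // sub0r addrC.
rewrite addnC iotaDl -map_comp; apply: eq_map => i /=.
by rewrite natrD addrAC subrr add0r.
Qed.

Lemma table_row_rotr n k (op : Q n -> Q n -> Q n) (p q : Q n) :
  (1 < n)%N -> (k <= n)%N ->
  table_row op q = rotr k (table_row op p) <->
  (forall y z : Q n, residue n z = residue n y + k%:R -> op q z = op p y).
Proof.
move=> n1 kn; pose back (z : Q n) := label n n1 (residue n z - k%:R).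
have rotE : rotr k (Q_enum n) = map back (Q_enum n).
  apply: (inj_map (@residue_inj n n1)); rewrite rotr_residue // -map_comp.
  by apply: eq_map => z /=; rewrite labelK.
rewrite /table_row -map_rotr rotE -map_comp.
split=> [/eq_in_map eq_row y z zy|shift].
  rewrite eq_row ?mem_Q_enum //=; congr (op p _); apply: (residue_inj _ n1).
  by rewrite labelK zy addrK.
by apply: eq_map => z /=; apply: shift; rewrite labelK subrK.
Qed.

(** Moving one row down and [k] columns to the right preserves the entry, and
    any two rows are linked by such steps without passing from the last row to
    the first; only the columns are read cyclically. *)
Lemma translatable_diagonal n k (op : Q n -> Q n -> Q n) (x y x' y' : Q n) :
    (1 < n)%N -> translatable k op ->
    residue n y - k%:R * residue n x = residue n y' - k%:R * residue n x' ->
  op x y = op x' y'.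
Proof.
move=> n1 [/andP[_ kn] rows].
have down d : forall x y x' y' : Q n, val x' = (val x + d)%N ->
    residue n y' = residue n y + k%:R * d%:R -> op x' y' = op x y.
  elim: d => [|d IHd] {}x {}y {}x' {}y' xx' yy'.
    congr op; first by apply: val_inj; rewrite xx' addn0.
    by apply: (residue_inj _ n1); rewrite yy' mulr0 addr0.
  have x2P : (0 < val x + d <= n)%N.
    have /andP[x0 _] := valP x; have /andP[_ x'n] := valP x'.
    by rewrite addn_gt0 x0 /= ltnW // -addnS -xx'.
  pose x2 : Q n := exist _ (val x + d)%N x2P.
  pose y2 := label n n1 (residue n y + k%:R * d%:R).
  transitivity (op x2 y2); last by apply: IHd; rewrite ?labelK.
  apply: (table_row_rotr n k op x2 x' n1 (ltnW kn)).1.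
    by apply: rows; rewrite xx' addnS.
  by rewrite labelK yy' -natr1; ring.
wlog le_xx' : x y x' y' / (val x <= val x')%N => [sym|] eq_diag.
  by case/orP: (leq_total (val x) (val x')) => /sym;
     [|move=> /(_ y' y (esym eq_diag))]; auto.
apply/esym/(down (val x' - val x)%N); rewrite ?subnKC //.
rewrite natrB // -!/(residue n _).
by rewrite -[residue n y'](subrK (k%:R * residue n x')) -eq_diag; ring.
Qed.

(** Idempotency prescribes the product on the main diagonal, where the
    difference [y - k x] equals [(1 - k) x].  The table entry there is [x], so
    distinct [x] give distinct differences, so they exhaust ['Z_n] and
    determine the whole table. *)
Lemma translatable_idempotent_affine n k (op : Q n -> Q n -> Q n) :
    (1 < n)%N -> translatable k op -> (forall x, op x x = x) ->
  exists2 u : 'Z_n, u * (1 - k%:R) = 1 &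
    forall x y, residue n (op x y) = u * (residue n y - k%:R * residue n x).
Proof.
move=> n1 tr idem.
have diag := fun x y x' y' => translatable_diagonal n k op x y x' y' n1 tr.
have inj : injective (fun z : 'Z_n => z * (1 - k%:R)).
  move=> z z' eq_z; rewrite -(labelK n n1 z) -(labelK n n1 z').
  congr residue; rewrite -[LHS]idem -[RHS]idem; apply: diag; rewrite !labelK.
  by move: eq_z; rewrite !mulrBr !mulr1 ![_ * k%:R]mulrC.
pose u : 'Z_n := invF inj 1.
have uk : u * (1 - k%:R) = 1 by exact: (f_invF inj 1).
exists u => // x y.
(* The main diagonal meets every line of slope k: z is the point where it
   meets the line through (x, y). *)
pose z := label n n1 (u * (residue n y - k%:R * residue n x)).
rewrite -(labelK n n1 (_ * _)) -/z -[in RHS](idem z); congr residue.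
apply: diag; rewrite labelK; set w := (_ - _).
by rewrite -[LHS]mul1r -[X in X * _ = _]uk; ring.
Qed.

(** * Affine operations *)

Section Affine.
Variables (n : nat) (op : Q n -> Q n -> Q n) (a : 'Z_n).
Hypothesis n1 : (1 < n)%N.
Hypothesis opE : forall x y : Q n,
  residue n (op x y) = a * residue n x + (1 - a) * residue n y.

(** Evaluating at the residues [0] and [1] isolates the coefficient of [y] in
    the pentagonal identity. *)
Lemma affine_pentagonal_root :
    (forall x y, op (op (op (op x y) x) y) x = y) ->
  a ^+ 4 - a ^+ 3 + a ^+ 2 - a + 1 = 0.
Proof.
move=> /(_ (label n n1 0) (label n n1 1)) /(congr1 (@residue n)).
rewrite !opE !labelK => eq1.
by rewrite -[X in _ + X]eq1; ring.
Qed.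

Lemma affine_quasigroup (b c : 'Z_n) :
  a * b = 1 -> (1 - a) * c = 1 -> quasigroup op.
Proof.
move=> ab ac; split=> x y.
  exists (label n n1 (c * (residue n y - a * residue n x))); split.
    by apply: (residue_inj _ n1); rewrite opE labelK mulrA ac; ring.
  move=> z <-; apply: (residue_inj _ n1); rewrite labelK opE.
  by rewrite -[RHS]mul1r -[X in _ = X * _]ac; ring.
exists (label n n1 (b * (residue n y - (1 - a) * residue n x))); split.
  by apply: (residue_inj _ n1); rewrite opE labelK mulrA ab; ring.
move=> z <-; apply: (residue_inj _ n1); rewrite labelK opE.
by rewrite -[RHS]mul1r -[X in _ = X * _]ab; ring.
Qed.

Lemma affine_pentagonal (c : 'Z_n) :
  a ^+ 4 - a ^+ 3 + a ^+ 2 - a + 1 = 0 -> (1 - a) * c = 1 -> pentagonal op.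
Proof.
move=> root ac; split.
- (* The constant term of the quartic exhibits the inverse of its root. *)
  apply: (affine_quasigroup (1 - a + a ^+ 2 - a ^+ 3) c) => //.
  by rewrite -[RHS]subr0 -root; ring.
- by move=> x; apply: (residue_inj _ n1); rewrite opE; ring.
- by move=> x y z t; apply: (residue_inj _ n1); rewrite !opE; ring.
move=> x y; apply: (residue_inj _ n1); rewrite !opE; apply/eqP.
rewrite -subr_eq0; apply/eqP.
(* The two sides differ by a multiple of x - y, by idempotency. *)
rewrite -[RHS](mul0r (residue n x - residue n y)) -root; ring.
Qed.

Lemma affine_translatable k :
  (0 < k < n)%N -> a + (1 - a) * k%:R = 0 -> translatable k op.
Proof.
move=> kn slope; have /andP[_ ltkn] := kn; split=> // p q qp.
apply: (table_row_rotr n k op p q n1 (ltnW ltkn)).2 => y z zy.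
apply: (residue_inj _ n1); rewrite !opE zy.
have -> : residue n q = residue n p + 1 by rewrite /residue qp natr1.
by rewrite -[RHS]addr0 -slope; ring.
Qed.

End Affine.

(** * The characterization *)

Theorem theorem4p2 (k n : nat) (op : Q n -> Q n -> Q n)
    (hk : (1 < k)%N) (hn : (k < n)%N) :
  (translatable k op /\ pentagonal op) <->
  (let m : int := k%:Z ^+ 4 - 2 * k%:Z ^+ 3 + 4 * k%:Z ^+ 2 - 3 * k%:Z + 1 in
   let a : int := (res n (- k%:Z ^+ 3 + k%:Z ^+ 2 - 3 * k%:Z + 1))%:Z in
   (n%:Z %| m)%Z /\
   forall x y : Q n,
     val (op x y) = res n (a * (val x)%:Z + (1 - a) * (val y)%:Z)).
Proof.
have n1 : (1 < n)%N := ltn_trans hk hn.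
pose K : 'Z_n := k%:R; move=> /=; set m := (X in (_ %| X)%Z).
set a := (X in res n X).
have mE : (n%:Z %| m)%Z = (modulus_poly _ K == 0).
  rewrite -intr_Zp_eq0 // /m /modulus_poly.
  by rewrite !(rmorphD, rmorphB, rmorphN, rmorphM, rmorphXn, rmorph1) /=.
have aE : (res n a)%:R = coef_poly _ K :> 'Z_n.
  rewrite res_Zp // /a /coef_poly.
  by rewrite !(rmorphD, rmorphB, rmorphN, rmorphM, rmorphXn, rmorph1) /=.
have opE x y : val (op x y) =
      res n ((res n a)%:Z * (val x)%:Z + (1 - (res n a)%:Z) * (val y)%:Z) <->
    residue n (op x y)
      = coef_poly _ K * residue n x + (1 - coef_poly _ K) * residue n y.
  set r := (X in res n X).
  have rE : r%:~R = coef_poly _ K * residue n x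
                    + (1 - coef_poly _ K) * residue n y :> 'Z_n.
    by rewrite /r rmorphD !rmorphM rmorphB /= -!pmulrn aE.
  rewrite -rE; split=> [opxy|opr]; first by rewrite /residue opxy res_Zp.
  have rP := res_bounds n r (ltnW n1).
  have -> // : op x y = exist _ (res n r) rP.
  by apply: (residue_inj _ n1); rewrite opr /residue /= res_Zp.
split=> [[tr [_ idem _ pent]]|[]].
  have [u uk opu] := translatable_idempotent_affine n k op n1 tr idem.
  have inv : (1 - (1 - u)) * (1 - K) = 1 by rewrite subKr.
  have opa x y : residue n (op x y)
      = (1 - u) * residue n x + (1 - (1 - u)) * residue n y.
    have uK : 1 - u = - (u * K) by rewrite -[in LHS]uk; rewrite /K; ring.
    by rewrite opu subKr uK -/K; ring.
  have m0 : modulus_poly _ K = 0.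
    rewrite -(modulus_poly_homogenization _ _ _ inv).
    by rewrite (affine_pentagonal_root n op _ n1 opa pent) mulr0.
  rewrite mE m0 eqxx; split=> // x y; apply/opE.
  by rewrite opa -(coef_poly_unique _ _ _ m0 uk) !subKr.
rewrite mE => /eqP m0 opv; have inv := coef_poly_inverse _ _ m0.
have opa x y := (opE x y).1 (opv x y).
split; last exact: affine_pentagonal n1 opa _ (coef_poly_root _ _ m0) inv.
apply: affine_translatable n1 opa _ _ _; first by rewrite (ltnW hk) hn.
by rewrite -/K -[RHS](subrr 1) -[X in _ = _ - X]inv; ring.
Qed.
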